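(* Suppose that $(d,p,\Omega,V)$ satisfies Assumption 1 (stated in the context) and that $\omega<-\lambda_0$. Then for every $m\ge 0$ there exists $M>0$ such that $\|\phi\|_{H^1}\le M$ for all $\phi\in S_{\le m}:=\{\phi\in X : S_{\Omega,\omega}(\phi)\le m\}$.
   Context: Let $d\ge 1$ be an integer and $D\subset\mathbb{R}^d$ a bounded domain on which homogeneous Dirichlet or periodic boundary conditions are imposed. $X$ denotes the space of complex-valued $H^1(D)$ functions satisfying the boundary conditions, with $\|\phi\|_{H^1}^2=\|\phi\|_{L^2}^2+\|\nabla\phi\|_{L^2}^2$ (all norms over $D$). Parameters: $\beta>0$, $\Omega\ge 0$, $\omega\in\mathbb{R}$, $p>1$. $L_z=\mathrm{i}(x_2\partial_{x_1}-x_1\partial_{x_2})$ if $d\ge2$ and $L_z=0$ if $d=1$. Assumption 1: $1<p<\frac{d+2}{d-2}$ if $d\ge3$ and $1<p<\infty$ if $d=1,2$; $V\in L^\infty(D)$ is real-valued; and one of the following holds: (a) $d=1$ (or $\Omega=0$) and $V(\mathbf{x})\ge0$ for all $\mathbf{x}\in D$; (b) $d\ge2$, $V(\mathbf{x})=\frac12\sum_{i=1}^d\gamma_i^2x_i^2$ with all $\gamma_i>0$, and $\Omega<\min\{\gamma_1,\gamma_2\}$. $L_\Omega(\phi)=-\Omega\int_D\overline{\phi}\,L_z\phi\,\mathrm{d}\mathbf{x}$. The action functional is $$S_{\Omega,\omega}(\phi)=\tfrac12\|\nabla\phi\|_{L^2}^2+\int_D V|\phi|^2\,\mathrm{d}\mathbf{x}+\tfrac{2\beta}{p+1}\|\phi\|_{L^{p+1}}^{p+1}+L_\Omega(\phi)+\omega\|\phi\|_{L^2}^2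 .$$ $\lambda_0=\inf\{\frac12\|\nabla u\|_{L^2}^2+\int_DV|u|^2\,\mathrm{d}\mathbf{x}+L_\Omega(u) : u\in X,\ \|u\|_{L^2}=1\}$. *)

(* Defs.v *)
From HB Require Import structures.
From mathcomp Require Import all_boot all_order all_algebra.
From mathcomp Require Import all_classical all_reals all_analysis.
From mathcomp Require Import complex.

Set Implicit Arguments.
Unset Strict Implicit.
Unset Printing Implicit Defensive.

Import Order.TTheory GRing.Theory Num.Theory.
Import numFieldTopology.Exports numFieldNormedType.Exports.

Local Open Scope classical_set_scope.
Local Open Scope ring_scope.
Local Open Scope complex_scope.

(* 'rV[R]_d carries its Borel sigma-algebra. *)
Section borel_rV.
Variables (R : realType) (d : nat).

Definition rV_borel : set (set 'rV[R]_d) := <<s @open 'rV[R]_d >>.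

Lemma rV_borel0 : rV_borel set0.
Proof. exact: sigma_algebra0. Qed.

Lemma rV_borelC A : rV_borel A -> rV_borel (~` A).
Proof. exact: sigma_algebraC. Qed.

Lemma rV_borel_bigcup (F : (set 'rV[R]_d)^nat) :
  (forall i, rV_borel (F i)) -> rV_borel (\bigcup_i F i).
Proof. exact: sigma_algebra_bigcup. Qed.

HB.instance Definition _ := @isMeasurable.Build
  (sigma_display (@open 'rV[R]_d)) 'rV[R]_d rV_borel
  rV_borel0 rV_borelC rV_borel_bigcup.

End borel_rV.

Section lebesgue_rV.
Variable R : realType.


Local Notation tR n := (n.-tuple (measurableTypeR R)).

Definition tcons n (p : measurableTypeR R * tR n) : tR n.+1 :=
  [tuple of p.1 :: p.2].

Lemma measurable_tcons n : measurable_fun setT (@tcons n).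
Proof. by apply: measurable_cons. Qed.

Section tuple_lebesgue_step.
Variables (n : nat) (m : {sigma_finite_measure set (tR n) -> \bar R}).

Definition tuple_lebesgueS : set (tR n.+1) -> \bar R :=
  pushforward (@lebesgue_measure R \x m)%E (@tcons n).

Let measureS : {measure set (tR n.+1) -> \bar R}.
Proof.
pose P : {measure set (measurableTypeR R * tR n) -> \bar R} :=
  [the {measure set _ -> \bar R} of (@lebesgue_measure R \x m)%E].
pose mu : {measure set (tR n.+1) -> \bar R} := pushforward P (@tcons n).
exact: (mu (@measurable_tcons n)).
Defined.

HB.instance Definition _ := isMeasure.Build _ _ _ tuple_lebesgueS
  (measure0 measureS) (measure_ge0 measureS)
  (@measure_semi_sigma_additive _ _ _ measureS).

Let sigma_finiteS : sigma_finite setT tuple_lebesgueS.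
Proof.
have /sigma_finiteP[F [TF ndF Foo]] := sigma_finiteT (@lebesgue_measure R).
have /sigma_finiteP[G [TG ndG Goo]] := sigma_finiteT m.
pose u (t : tR n.+1) : measurableTypeR R * tR n :=
  (thead t, [tuple of behead t]).
have mu : measurable_fun setT u.
  apply: measurable_fun_pair; first exact: measurable_tnth.
  exact: measurable_behead.
have uK p : u (tcons p) = p.
  by case: p => x t; rewrite /u /tcons theadE; congr pair; exact/val_inj.
exists (fun k => u @^-1` (F k `*` G k)).
  rewrite -preimage_bigcup; apply/esym; rewrite -subTset => t _ /=.
  have [k _ Fk] : (\bigcup_i F i) (u t).1 by rewrite -TF.
  have [l _ Gl] : (\bigcup_i G i) (u t).2 by rewrite -TG.
  exists (maxn k l) => //; split.
  - by move: Fk; exact/subsetPset/ndF/leq_maxl.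
  - by move: Gl; exact/subsetPset/ndG/leq_maxr.
move=> k; have [mF Fk] := Foo k; have [mG Gk] := Goo k; split.
  by rewrite -[X in measurable X]setTI; apply: mu => //; exact: measurableX.
rewrite /tuple_lebesgueS /pushforward -comp_preimage.
rewrite (_ : (u \o @tcons n) = id); last by apply/funext => p /=; rewrite uK.
rewrite preimage_id product_measure1E//.
by rewrite lte_mul_pinfty// ge0_fin_numE.
Qed.

HB.instance Definition _ := Measure_isSigmaFinite.Build _ _ _ tuple_lebesgueS
  sigma_finiteS.

End tuple_lebesgue_step.

Fixpoint tuple_lebesgue n : {sigma_finite_measure set (tR n) -> \bar R} :=
  match n with
  | 0 => dirac ([tuple] : tR 0)
  | n'.+1 => tuple_lebesgueS (tuple_lebesgue n')
  end.

Definition rV_of_tuple n (t : tR n) : 'rV[R]_n := \row_i tnth t i.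

Lemma measurable_rV_of_tuple n : measurable_fun setT (@rV_of_tuple n).
Proof.
apply: (@measurability _ _ _ _ _ _ (@open 'rV[R]_n)) => // _ [U oU <-].
rewrite setTI.
pose q (p : n.-tuple rat) : 'rV[R]_n := \row_i ratr (tnth p i).
pose B (p : n.-tuple rat * nat) := ball (q p.1) (p.2.+1%:R^-1).
have -> : U = \bigcup_(p in [set p | B p `<=` U]) B p.
  apply/seteqP; split=> [x Ux|x [p Up]]; last exact: Up.
  have /nbhs_ballP[e /= e0 eU] : nbhs x U by exact: open_nbhs_nbhs.
  have [k ke] : exists k, (k.+1%:R^-1 : R) < e / 2.
    have e20 : 0 < e / 2 by rewrite divr_gt0.
    near \oo => k; exists k; near: k; exact: (near_infty_natSinv_lt (PosNum e20)).
  have k0 : 0 < (k.+1%:R^-1 : R) by rewrite invr_gt0.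
  have /choice[r rP] : forall i, exists r : rat,
      (ratr r : R) \in `](x ord0 i - k.+1%:R^-1), (x ord0 i)[.
    by move=> i; apply: rat_in_itvoo; rewrite ltrBlDr ltrDl.
  have xB : ball (q [tuple r i | i < n]) k.+1%:R^-1 x.
    split=> // i j; rewrite (ord1 i) mxE tnth_mktuple.
    have := rP j; rewrite in_itv/= => /andP[r1 r2].
    rewrite /ball/= ltr_distlC; apply/andP; split.
      by apply: lt_trans r2 => //; rewrite ltrBlDr ltrDl.
    by rewrite -ltrBlDr.
  exists ([tuple r i | i < n], k) => //= y By; apply: eU.
  rewrite [e]splitr; apply: (@ball_triangle _ _ (q [tuple r i | i < n])).
    by apply: ball_sym; apply: le_ball xB; exact: ltW.
  by apply: le_ball By; exact: ltW.

rewrite preimage_bigcup bigcup_mkcond.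
apply: countable_bigcupT_measurable => // p; case: ifP => // _.
rewrite (_ : _ @^-1` _ = \bigcap_(i in [set: 'I_n])
    (fun t : tR n => tnth t i) @^-1` ball (ratr (tnth p.1 i) : R) p.2.+1%:R^-1).
  apply: fin_bigcap_measurable => // i _.
  rewrite -[X in measurable X]setTI; apply: measurable_tnth => //.
  by rewrite ball_itv; exact: measurable_itv.
apply/seteqP; split=> [t [_ tB] i _|t tB].
  by have := tB ord0 i; rewrite !mxE.
split=> [|j i]; first by rewrite invr_gt0.
by rewrite (ord1 j) !mxE; exact: tB.
Unshelve. all: by end_near.
Qed.


Lemma tuple_lebesgue_box n (A : 'I_n -> set (measurableTypeR R)) :
  (forall i, measurable (A i)) ->
  tuple_lebesgue n [set t | forall i, A i (tnth t i)] =
  (\prod_(i < n) @lebesgue_measure R (A i))%E.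
Proof.
elim: n A => [|n IH] A mA.
  by rewrite big_ord0 /= diracE mem_set// => -[].
have mT : measurable [set t : tR n | forall i, A (lift ord0 i) (tnth t i)].
  rewrite (_ : [set _ | _] = \bigcap_(i in [set: 'I_n])
      (fun t : tR n => tnth t i) @^-1` A (lift ord0 i)); last first.
    by apply/seteqP; split=> [t tA i _|t tA i]; exact: tA.
  apply: fin_bigcap_measurable => // i _.
  by rewrite -[X in measurable X]setTI; exact: measurable_tnth.
rewrite big_ord_recl -IH// -product_measure1E//.
congr (product_measure1 _ _ _); apply/seteqP; split=> [[x t] /= xA|[x t] /= [xA tA] i].
  by split=> [|i]; [exact: (xA ord0)|have := xA (lift ord0 i); rewrite tnthS].
by have [j ->|->] := unliftP ord0 i; rewrite ?tnthS.
Qed.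

Section lebesgue_rV_measure.
Variable n : nat.

Definition lebesgue_rV : set 'rV[R]_n -> \bar R :=
  pushforward (tuple_lebesgue n) (@rV_of_tuple n).

Let measure_rV : {measure set 'rV[R]_n -> \bar R}.
Proof.
pose mu : {measure set 'rV[R]_n -> \bar R} :=
  pushforward (tuple_lebesgue n) (@rV_of_tuple n).
exact: (mu (@measurable_rV_of_tuple n)).
Defined.

HB.instance Definition _ := isMeasure.Build _ _ _ lebesgue_rV
  (measure0 measure_rV) (measure_ge0 measure_rV)
  (@measure_semi_sigma_additive _ _ _ measure_rV).

Lemma lebesgue_rV_box (A : 'I_n -> set (measurableTypeR R)) :
  (forall i, measurable (A i)) ->
  lebesgue_rV [set x | forall i, A i (x ord0 i)] =
  (\prod_(i < n) @lebesgue_measure R (A i))%E.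
Proof.
move=> mA; rewrite -tuple_lebesgue_box//; congr (tuple_lebesgue n _).
by apply/seteqP; split=> t tA i; have := tA i; rewrite mxE.
Qed.

End lebesgue_rV_measure.

End lebesgue_rV.

Section function_spaces.
Variables (R : realType) (d : nat).
Local Notation E := 'rV[R]_d.
Local Notation mu := (@lebesgue_rV R d).
Implicit Types (D : set E) (i : 'I_d) (phi psi : E -> R[i]).

Definition unitv i : E := delta_mx 0 i.

Definition domain D := [/\ D !=set0, open D, connected D & bounded_set D].

Definition cintegral D phi : R[i] :=
  (\int[mu]_(x in D) complex.Re (phi x)) +i* (\int[mu]_(x in D) complex.Im (phi x)).

Definition cmeasurable D phi :=
  measurable_fun D (fun x => complex.Re (phi x)) /\
  measurable_fun D (fun x => complex.Im (phi x)).

(* f \_ D is f on D and 0 off D. *)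
Definition rLnorm D (p : \bar R) (f : E -> R) : \bar R :=
  'N[mu]_p[EFin \o (f \_ D)].

Definition cLnorm D (p : \bar R) phi : \bar R :=
  rLnorm D p (fun x => Normc.normc (phi x)).

Definition L2 D phi := cmeasurable D phi /\ (cLnorm D 2%:E phi < +oo)%E.

Definition Linfty D (f : E -> R) :=
  measurable_fun D f /\ (rLnorm D +oo f < +oo)%E.

Fixpoint iter_partial (s : seq 'I_d) (f : E -> R) : E -> R :=
  if s is i :: s' then 'D_(unitv i) (iter_partial s' f) else f.

Definition smooth (f : E -> R) :=
  forall s, continuous (iter_partial s f) /\
    forall i x, derivable (iter_partial s f) x (unitv i).

Definition csmooth phi :=
  smooth (fun x => complex.Re (phi x)) /\ smooth (fun x => complex.Im (phi x)).

Definition compact_support (T : zmodType) D (f : E -> T) :=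
  exists K, [/\ compact K, K `<=` D & forall x, ~ K x -> f x = 0].

(* g is the weak derivative of phi on D in the direction of x_i; real-valued
   test functions suffice by linearity. *)
Definition weak_partial D i phi (g : E -> R[i]) :=
  forall f : E -> R, smooth f -> compact_support D f ->
    cintegral D (fun x => phi x * ('D_(unitv i) f x)%:C) =
    - cintegral D (fun x => g x * (f x)%:C).

Definition H1 D phi :=
  L2 D phi /\ forall i, exists2 g, L2 D g & weak_partial D i phi g.

(* A chosen representative, unique up to a null set when phi is in H^1(D). *)
Definition wpartial D i phi : E -> R[i] :=
  xget (fun=> 0) [set g | L2 D g /\ weak_partial D i phi g].

(* The library's norm on row vectors is the sup norm, hence the explicit
   Euclidean norm of the gradient. *)
Definition grad_norm D phi : \bar R :=
  rLnorm D 2%:E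
    (fun x => Num.sqrt (\sum_(i < d) Normc.normc (wpartial D i phi x) ^+ 2)).

Definition H1norm D phi : \bar R :=
  ((cLnorm D 2%:E phi ^+ 2 + grad_norm D phi ^+ 2) `^ 2^-1)%E.


(* Periodic a b: periodic on the box (a_1, b_1) x ... x (a_d, b_d). *)
Inductive boundary := Dirichlet | Periodic of E & E.

Definition obox (a b : E) : set E :=
  [set x | forall i, a ord0 i < x ord0 i < b ord0 i].

Definition compatible (bc : boundary) D :=
  if bc is Periodic a b then D = obox a b else True.

Definition bc_smooth (bc : boundary) D phi :=
  csmooth phi /\
  match bc with
  | Dirichlet => compact_support D phi
  | Periodic a b =>
      forall i x, phi (x + (b ord0 i - a ord0 i) *: unitv i) = phi x
  end.

(* H^1_0(D), resp. H^1_per(D): the closure in H^1(D) of the smooth functions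
   satisfying the boundary conditions. *)
Definition X (bc : boundary) D phi :=
  H1 D phi /\ forall eps : R, 0 < eps ->
    exists2 psi, bc_smooth bc D psi & (H1norm D (phi \- psi)%R < eps%:E)%E.

(* Indices are 0-based: coord x 0 is x_1 and coord x 1 is x_2. *)
Definition coord (v : E) (k : nat) : R := oapp (v ord0) 0 (insub k).

Definition wpartialn D (k : nat) phi : E -> R[i] :=
  oapp (fun i => wpartial D i phi) (fun=> 0) (insub k).

Definition Lz D phi : E -> R[i] := fun x =>
  if (2 <= d)%N then
    'i%C * ((coord x 1)%:C * wpartialn D 0 phi x
          - (coord x 0)%:C * wpartialn D 1 phi x)
  else 0.

Definition LOmega D (Omega : R) phi : R[i] :=
  - (Omega%:C * cintegral D (fun x => (phi x)^*%C * Lz D phi x)).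

(* Re (LOmega ...): on X the operator L_z is symmetric, so LOmega is real there. *)
Definition quadratic_energy D (V : E -> R) (Omega : R) phi : \bar R :=
  ((2^-1)%:E * grad_norm D phi ^+ 2
   + \int[mu]_(x in D) (V x * Normc.normc (phi x) ^+ 2)%:E
   + (complex.Re (LOmega D Omega phi))%:E)%E.

(* Takes the value +oo if phi is not in L^{p+1}(D). *)
Definition action D (V : E -> R) (beta Omega omega p : R) phi : \bar R :=
  ((2^-1)%:E * grad_norm D phi ^+ 2
   + \int[mu]_(x in D) (V x * Normc.normc (phi x) ^+ 2)%:E
   + (2 * beta / (p + 1))%:E * cLnorm D (p + 1)%:E phi `^ (p + 1)
   + (complex.Re (LOmega D Omega phi))%:E
   + omega%:E * cLnorm D 2%:E phi ^+ 2)%E.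

Definition lambda0 (bc : boundary) D (V : E -> R) (Omega : R) : \bar R :=
  ereal_inf [set quadratic_energy D V Omega u |
             u in [set u | X bc D u /\ cLnorm D 2%:E u = 1%E]].

Definition sublevel (bc : boundary) D (V : E -> R) (beta Omega omega p m : R) :
    set (E -> R[i]) :=
  [set phi | X bc D phi /\ (action D V beta Omega omega p phi <= m%:E)%E].

Definition assumption1 D (V : E -> R) (Omega p : R) :=
  [/\ 1 < p,
      (3 <= d)%N -> p < (d%:R + 2) / (d%:R - 2),
      Linfty D V &
      ((d = 1%N \/ Omega = 0) /\ (forall x, D x -> 0 <= V x)) \/
      [/\ (2 <= d)%N &
          exists gamma : E,
            [/\ forall i, 0 < gamma ord0 i,
                forall x, D x -> V x =
                  2^-1 * \sum_(i < d) gamma ord0 i ^+ 2 * x ord0 i ^+ 2 &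
                Omega < Num.min (coord gamma 0) (coord gamma 1)]]].

End function_spaces.
Arguments Dirichlet {R d}.

(* Main.v *)
(* Coercivity comes from the nonlinear term alone.  Since D is bounded, Young's
   inequality bounds the rotation term below by -1/4 |grad phi|^2 - C |phi|^2,
   and V >= 0 on D in both cases of Assumption 1.  As p + 1 > 2, a pointwise
   bound K t^2 <= c t^(p+1) + C' integrated over D (of finite measure) absorbs
   all the L^2 terms, whatever the sign and size of omega, at the cost of an
   additive constant. *)
Require Import Defs.
From mathcomp Require Import all_boot all_order all_algebra.
From mathcomp Require Import all_classical all_reals all_analysis.
From mathcomp Require Import complex measurable_realfun ring lra.

Import Order.TTheory GRing.Theory Num.Theory.
Import numFieldTopology.Exports numFieldNormedType.Exports.

Local Open Scope classical_set_scope.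
Local Open Scope ring_scope.

Set Implicit Arguments.
Unset Strict Implicit.
Unset Printing Implicit Defensive.

(** * Pointwise inequalities: superquadratic growth and Young's inequality *)

Lemma sqr_le_powR (R : realType) (q K c : R) : 2 < q -> 0 <= K -> 0 < c ->
  exists2 C, 0 <= C & forall t, 0 <= t -> K * t ^+ 2 <= c * t `^ q + C.
Proof.
move=> q2 K0 c0; pose t0 := (K / c) `^ (q - 2)^-1.
have q20 : 0 < q - 2 by lra.
have C0 : 0 <= K * t0 ^+ 2 by rewrite mulr_ge0// sqr_ge0.
exists (K * t0 ^+ 2) => // t tge0.
have [tt0|t0t] := leP t t0.
  rewrite ler_wpDl ?mulr_ge0 ?powR_ge0 ?(ltW c0)//.
  by rewrite ler_wpM2l// lerXn2r// nnegrE powR_ge0.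
apply: ler_wpDr => //.
have tgt0 : 0 < t by rewrite (le_lt_trans _ t0t)// powR_ge0.
have -> : t `^ q = t ^+ 2 * t `^ (q - 2).
  rewrite -powR_mulrn// -powRD; last by rewrite (gt_eqF tgt0) implybT.
  by congr (_ `^ _); rewrite addrC subrK.
rewrite [leRHS]mulrCA [leLHS]mulrC ler_wpM2l ?sqr_ge0// -ler_pdivrMl// mulrC.
have -> : K / c = t0 `^ (q - 2).
  by rewrite /t0 -powRrM mulVf ?gt_eqF// powRr1// divr_ge0// ltW.
by rewrite ge0_ler_powR ?nnegrE ?powR_ge0 ?ltW.
Qed.

Lemma poweR2 (R : realType) (x : \bar R) : (0 <= x -> x `^ 2 = x ^+ 2)%E.
Proof.
case: x => [r| |//]; last by move=> _; rewrite poweRyr ?expe2 ?mulyy ?pnatr_eq0.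
by rewrite lee_fin => r0; rewrite poweR_EFin powR_mulrn// expe2 -EFinM expr2.
Qed.

Lemma sqr_normcE (R : realType) (z : R[i]) :
  Normc.normc z ^+ 2 = complex.Re z ^+ 2 + complex.Im z ^+ 2.
Proof. by case: z => a b; rewrite /= sqr_sqrtr// addr_ge0// sqr_ge0. Qed.

(** The real part is a sum of four products of a coordinate, a component of [g1] or [g2] and a
    component of [z]. Young's inequality for each costs a quarter of the square of its derivative
    factor. Each component of [z] occurs twice, whence the factor 2. *)
Lemma angular_le (R : realType) (Omega r x y : R) (z g1 g2 : R[i]) :
  0 <= Omega -> `|x| <= r -> `|y| <= r ->
  Omega * `|complex.Re (z^*%C * ('i%C * (y%:C%C * g1 - x%:C%C * g2)))| <=
  4^-1 * (Normc.normc g1 ^+ 2 + Normc.normc g2 ^+ 2) +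
  2 * (Omega * r) ^+ 2 * Normc.normc z ^+ 2.
Proof.
move=> O0 xr yr; rewrite !sqr_normcE.
case: z g1 g2 => [a b] [g h] [k l] /=; simpc => /=.
have young s u v : `|s| <= r -> 
    Omega * `|s * u * v| <= 4^-1 * u ^+ 2 + (Omega * r) ^+ 2 * v ^+ 2.
  move=> sr; rewrite !normrM.
  have r0 : 0 <= r by rewrite (le_trans _ sr).
  apply: (@le_trans _ _ (Omega * (r * `|u| * `|v|))).
    by rewrite ler_wpM2l// !ler_wpM2r.
  rewrite -(real_normK (num_real u)) -(real_normK (num_real v)).
  (* Completing the square: the cross term of this square is exactly the product to be bounded. *)
  have := sqr_ge0 (`|u| / 2 - Omega * r * `|v|); nra.
have h1 := young y h a yr; have h2 := young x l a xr.
have h3 := young y g b yr; have h4 := young x k b xr.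
set F := (X in `|X|).
have -> : F = - (y * h * a) + x * l * a + y * g * b - x * k * b.
  by rewrite /F; ring.
apply: (@le_trans _ _ (Omega *
    (`|y * h * a| + `|x * l * a| + `|y * g * b| + `|x * k * b|))).
  rewrite ler_wpM2l// (le_trans (ler_normB _ _))// lerD2r.
  rewrite (le_trans (ler_normD _ _))// lerD2r.
  by rewrite (le_trans (ler_normD _ _))// lerD2r normrN.
lra.
Qed.

(** * Size and measurability of the bounded domain *)

Section bounded_domain.
Variables (R : realType) (d : nat) (D : set 'rV[R]_d).
Hypothesis hD : domain D.
Local Notation mu := (@lebesgue_rV R d).

Lemma measurable_domain : measurable D.
Proof. by case: hD => _ oD _ _; exact: sub_sigma_algebra. Qed.

Lemma domain_coord_le :
  exists2 r : R, 0 < r & forall x (i : 'I_d), D x -> `|x ord0 i| <= r.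
Proof.
(* [bounded_set] bounds the norm only by numbers strictly above [M], hence the added 1, which also
   makes [r] positive. *)
case: hD => _ _ _ [M [Mreal DM]]; pose r := `|M| + 1.
have r0 : 0 < r by rewrite ltr_wpDl.
exists r => // x i Dx.
have xr : `|x| <= r.
  by apply: DM => //; rewrite (le_lt_trans (ler_norm M))// ltrDl.
apply: le_trans xr; rewrite [leRHS]/Num.norm/= mx_normrE.
by apply/bigmax_geP; right => /=; exists (ord0, i).
Qed.

(** The domain lies in the cube of half-side [r], whose measure is a finite product of finite
    lengths. *)
Lemma lebesgue_domain_lty : (mu D < +oo)%E.
Proof.
have [r r0 rP] := domain_coord_le.
have mI (i : 'I_d) : measurable (`[- r, r]%classic : set (measurableTypeR R)).
  exact: measurable_itv.
have boxE := lebesgue_rV_box mI.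
apply: (@le_lt_trans _ _
    (mu [set x | forall i : 'I_d, `[- r, r]%classic (x ord0 i)])).
  apply: le_measure; rewrite ?inE.
  - exact: measurable_domain.
  (* The cube is Borel as a finite intersection of closed slabs, preimages of an interval under the
     continuous coordinates. *)
  - rewrite [X in measurable X](_ : _ = \bigcap_(i in [set: 'I_d])
        (fun x : 'rV[R]_d => x ord0 i) @^-1` `[- r, r]%classic).
      apply: fin_bigcap_measurable => // i _.
      rewrite -[X in measurable X]setCK; apply: measurableC.
      apply: sub_sigma_algebra; apply: closed_openC.
      apply: preimage_closed => [x _|]; first exact: coord_continuous.
      exact: interval_closed.
    by apply/seteqP; split=> [x xr i _|x xr i]; exact: xr.
  - by move=> x Dx i /=; rewrite in_itv/= -ler_norml rP.
rewrite boxE ltey_eq; apply/orP; left.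
apply: (big_ind (fun x : \bar R => x \is a fin_num)) => // [x y|i _].
  exact: fin_numM.
by rewrite /= lebesgue_measure_itv/= lte_fin; case: ifP.
Qed.

Lemma measurable_coord k : measurable_fun D ((@Defs.coord R d)^~ k).
Proof.
rewrite /Defs.coord; case: insubP => [i _ _|_] /=; last exact: measurable_cst.
move=> mD; apply: (measurability _ (RGenOInfty.measurableE R)) => //.
move=> _ [_ [a ->] <-]; apply: measurableI => //.
rewrite set_itvE; apply: sub_sigma_algebra.
by apply: open_comp => [x _|]; [exact: coord_continuous|exact: open_gt].
Qed.

End bounded_domain.

(** * Lebesgue norms as integrals over the domain *)

Section Lebesgue_norms.
Variables (R : realType) (d : nat) (D : set 'rV[R]_d).
Local Notation mu := (@lebesgue_rV R d).

(** The norm is that of the extension by zero; as [q != 0], the power of this extension still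
    vanishes off [D]. *)
Lemma rLnorm_powR (q : R) (f : 'rV[R]_d -> R) : q != 0 ->
  (rLnorm D q%:E f `^ q = \int[mu]_(x in D) (`|f x| `^ q)%:E)%E.
Proof.
move=> q0; rewrite poweR_Lnorm// [RHS]integral_mkcond.
apply: eq_integral => x _; rewrite /= !patchE; case: ifP => // _.
by rewrite normr0 powR0.
Qed.

Lemma rLnorm_sqr (f : 'rV[R]_d -> R) :
  (rLnorm D 2%:E f ^+ 2 = \int[mu]_(x in D) (f x ^+ 2)%:E)%E.
Proof.
rewrite -poweR2 ?Lnorm_ge0// rLnorm_powR ?pnatr_eq0//.
by apply: eq_integral => x _; rewrite powR_mulrn// real_normK// num_real.
Qed.

Lemma measurable_normc (phi : 'rV[R]_d -> R[i]) : cmeasurable D phi ->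
  measurable_fun D (fun x => Normc.normc (phi x)).
Proof.
move=> [mRe mIm].
rewrite (_ : (fun _ => _) = Num.sqrt \o
    (fun x => complex.Re (phi x) ^+ 2 + complex.Im (phi x) ^+ 2)).
  apply: measurableT_comp.
    by apply: continuous_measurable_fun; exact: sqrt_continuous.
  by apply: measurable_funD; exact: measurable_funX.
by apply/funext => x /=; case: (phi x).
Qed.

Lemma integrable_sqr_normc (phi : 'rV[R]_d -> R[i]) : L2 D phi ->
  mu.-integrable D (EFin \o (fun x => Normc.normc (phi x) ^+ 2)).
Proof.
move=> [mphi phioo]; apply/integrableP; split.
  apply/measurable_EFinP; apply: measurable_funX; exact: measurable_normc.
under eq_integral do rewrite /= ger0_norm ?sqr_ge0//.
by rewrite -rLnorm_sqr -poweR2 ?Lnorm_ge0// poweR_lty.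
Qed.

(** Membership in H^1 provides a weak derivative, so [xget] returns a genuine one and not its
    default value 0. *)
Lemma L2_wpartial (i : 'I_d) (phi : 'rV[R]_d -> R[i]) :
  H1 D phi -> L2 D (wpartial D i phi).
Proof.
move=> [_ /(_ i)[g gL2 gphi]]; rewrite /wpartial.
by have [] : [set g | L2 D g /\ weak_partial D i phi g] (wpartial D i phi)
  by apply: xgetPex; exists g.
Qed.

End Lebesgue_norms.

(** * Integrated bounds for the rotation term and the nonlinear term *)

Section H1_energy.
Variables (R : realType) (d : nat) (D : set 'rV[R]_d).
Hypothesis hD : domain D.
Local Notation mu := (@lebesgue_rV R d).
Local Notation sqr_grad phi :=
  (fun x => \sum_(i < d) Normc.normc (wpartial D i phi x) ^+ 2).
Local Notation sqr_mod phi := (fun x => Normc.normc (phi x) ^+ 2).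
Let mD := measurable_domain hD.

Lemma grad_norm_sqr (phi : 'rV[R]_d -> R[i]) :
  (grad_norm D phi ^+ 2 = \int[mu]_(x in D) (sqr_grad phi x)%:E)%E.
Proof.
rewrite rLnorm_sqr//; apply: eq_integral => x _.
by rewrite sqr_sqrtr// sumr_ge0// => i _; exact: sqr_ge0.
Qed.

Lemma integrable_sqr_grad (phi : 'rV[R]_d -> R[i]) : H1 D phi ->
  mu.-integrable D (EFin \o sqr_grad phi).
Proof.
move=> phiH1.
rewrite (_ : EFin \o _ = (fun x =>
    \sum_(i < d) (Normc.normc (wpartial D i phi x) ^+ 2)%:E)%E).
  by apply: integrable_sum => // i _; exact/integrable_sqr_normc/L2_wpartial.
by apply/funext => x; rewrite /= sumEFin.
Qed.

(** Integrates [angular_le] over [D]. The factor 1/4 leaves half of the kinetic energy available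
    after the rotation term is absorbed. *)
Lemma LOmega_ge (r Omega : R) (phi : 'rV[R]_d -> R[i]) :
    (forall x (i : 'I_d), D x -> `|x ord0 i| <= r) -> 0 <= Omega ->
    H1 D phi ->
  - (4^-1 * (\int[mu]_(x in D) sqr_grad phi x) +
     2 * (Omega * r) ^+ 2 * (\int[mu]_(x in D) sqr_mod phi x)) <=
  complex.Re (LOmega D Omega phi).
Proof.
move=> rP O0 phiH1.
have IN : mu.-integrable D (EFin \o sqr_mod phi).
  by apply: integrable_sqr_normc => //; case: phiH1.
have IG := integrable_sqr_grad phiH1.
pose F x := complex.Re ((phi x)^*%C * Lz D phi x).
have -> : complex.Re (LOmega D Omega phi) = - (Omega * \int[mu]_(x in D) F x).
  by rewrite /LOmega /cintegral; simpc.
rewrite lerN2.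
have d2_or : (forall x, F x = 0) \/ (2 <= d)%N.
  have [d2|d2] := boolP (2 <= d)%N; [by right|left => x].
  by rewrite /F /Lz (negbTE d2) mulr0.
(* Stated for any [Om]: the value 1 gives the integrability of [F] even when [Omega] is 0, and the
   value [Omega] gives the final estimate. *)
have F_le Om x : 0 <= Om -> D x -> Om * `|F x| <=
    4^-1 * sqr_grad phi x + 2 * (Om * r) ^+ 2 * sqr_mod phi x.
  move=> Om0 Dx; have G0 (P : pred 'I_d) :
      0 <= \sum_(i < d | P i) Normc.normc (wpartial D i phi x) ^+ 2.
    by apply: sumr_ge0 => i _; exact: sqr_ge0.
  case: d2_or => [->|d2].
    rewrite normr0 mulr0; apply: addr_ge0; apply: mulr_ge0.
    - by rewrite invr_ge0.
    - exact: (G0 xpredT).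
    - by rewrite mulr_ge0// sqr_ge0.
    - exact: sqr_ge0.
  have d1 : (1 < d)%N by [].
  have d0 : (0 < d)%N by exact: ltnW.
  have coord_le k : (k < d)%N -> `|Defs.coord x k| <= r.
    by move=> kd; rewrite /Defs.coord insubT/=; exact: rP.
  have := angular_le (phi x) (wpartialn D 0 phi x) (wpartialn D 1 phi x)
    Om0 (coord_le _ d0) (coord_le _ d1).
  rewrite /F /Lz d2 => /le_trans; apply; rewrite lerD2r ler_wpM2l//.
  (* Only the first two partial derivatives enter [Lz]; the remaining squares in the full gradient
     are nonnegative. *)
  rewrite /wpartialn !insubT/= (bigD1 (Ordinal d0))//= lerD2l.
  by rewrite (bigD1 (Ordinal d1))//= lerDl.
have mF : measurable_fun D F.
  case: d2_or => [F0|d2].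
    by rewrite (_ : F = cst 0); [exact: measurable_cst|exact/funext].
  have mW k : cmeasurable D (wpartialn D k phi).
    rewrite /wpartialn; case: insubP => [i _ _|_] /=.
      by have [] := L2_wpartial i phiH1.
    by split; exact: measurable_cst.
  have [[mphiR mphiI] _] := phiH1.1.
  have [m0R m0I] := mW 0%N; have [m1R m1I] := mW 1%N.
  (* Written out in real and imaginary parts, [F] is a polynomial in measurable real functions. *)
  rewrite (_ : F = (fun x => complex.Im (phi x) *
      (Defs.coord x 1 * complex.Re (wpartialn D 0 phi x) -
       Defs.coord x 0 * complex.Re (wpartialn D 1 phi x)) -
    complex.Re (phi x) *
      (Defs.coord x 1 * complex.Im (wpartialn D 0 phi x) -
       Defs.coord x 0 * complex.Im (wpartialn D 1 phi x)))).
    by do ![apply: measurable_funB|apply: measurable_funM|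
            apply: measurable_coord].
  apply/funext => x; rewrite /F /Lz d2.
  case: (phi x) (wpartialn D 0 phi x) (wpartialn D 1 phi x).
  by move=> a b [g h] [k l]; simpc => /=; ring.
have Idom Om : mu.-integrable D (EFin \o
    (fun x => 4^-1 * sqr_grad phi x + 2 * (Om * r) ^+ 2 * sqr_mod phi x)).
  rewrite (_ : EFin \o _ = (fun x => (4^-1)%:E * (sqr_grad phi x)%:E +
      (2 * (Om * r) ^+ 2)%:E * (sqr_mod phi x)%:E)%E).
    by apply: integrableD => //; exact: integrableZl.
  by apply/funext => x; rewrite /= EFinD !EFinM.
have IF : mu.-integrable D (EFin \o F).
  apply: le_integrable (Idom 1) => //; first exact/measurable_EFinP.
  move=> x Dx; rewrite lee_fin/=.
  have := F_le 1 x ler01 Dx; rewrite mul1r => /le_trans; apply.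
  exact: ler_norm.
have IaF : mu.-integrable D (EFin \o (fun x => Omega * `|F x|)).
  rewrite (_ : EFin \o _ = (fun x => Omega%:E * `|(F x)%:E|)%E).
    by apply: integrableZl => //; exact: integrable_abse.
  by apply/funext => x; rewrite /= EFinM.
apply: (@le_trans _ _ (\int[mu]_(x in D) (Omega * `|F x|))).
  rewrite RintegralZl//; last exact: (integrable_norm IF).
  rewrite ler_wpM2l// (le_trans (ler_norm _))//.
  exact: le_normr_Rintegral.
apply: (@le_trans _ _ (\int[mu]_(x in D)
    (4^-1 * sqr_grad phi x + 2 * (Omega * r) ^+ 2 * sqr_mod phi x))).
  by apply: le_Rintegral => // x Dx; exact: F_le.
rewrite RintegralD//; last 2 first.
- rewrite (_ : EFin \o _ = (fun x => (4^-1)%:E * (sqr_grad phi x)%:E)%E).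
    exact: integrableZl.
  by apply/funext => x; rewrite /= EFinM.
- rewrite (_ : EFin \o _ =
      (fun x => (2 * (Omega * r) ^+ 2)%:E * (sqr_mod phi x)%:E)%E).
    exact: integrableZl.
  by apply/funext => x; rewrite /= EFinM.
by rewrite !RintegralZl.
Qed.

(** Integrates the pointwise bound. It is stated in the extended reals, so that an infinite [q]-norm
    is covered too. *)
Lemma sqr_mod_le_powR (q K c C : R) (phi : 'rV[R]_d -> R[i]) :
    q != 0 -> 0 <= K -> 0 <= c -> 0 <= C ->
    (forall t, 0 <= t -> K * t ^+ 2 <= c * t `^ q + C) -> L2 D phi ->
  (K%:E * (\int[mu]_(x in D) (sqr_mod phi x)%:E) <=
   c%:E * cLnorm D q%:E phi `^ q + C%:E * mu D)%E.
Proof.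
move=> q0 K0 c0 C0 KcC [mphi _].
have normc_ge0 x : 0 <= Normc.normc (phi x).
  by case: (phi x) => *; exact: sqrtr_ge0.
have mN := measurable_normc mphi.
have mNq : measurable_fun D (fun x => Normc.normc (phi x) `^ q).
  by apply: (measurableT_comp (measurable_powR q)).
rewrite rLnorm_powR//.
under [in leRHS]eq_integral do rewrite ger0_norm//.
rewrite -ge0_integralZl_EFin//; last 2 first.
- by move=> x _; rewrite lee_fin sqr_ge0.
- by apply/measurable_EFinP; exact: measurable_funX.
rewrite -ge0_integralZl_EFin//; last 2 first.
- by move=> x _; rewrite lee_fin powR_ge0.
- exact/measurable_EFinP.
rewrite -integral_cst// -ge0_integralD//; last 2 first.
- by move=> x _; rewrite -EFinM lee_fin mulr_ge0// powR_ge0.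
- by apply/measurable_EFinP; exact: measurable_funM.
apply: ge0_le_integral => //.
- by move=> x _; rewrite -EFinM lee_fin mulr_ge0// sqr_ge0.
- apply/measurable_EFinP; apply: measurable_funM => //.
  exact: measurable_funX.
- apply: emeasurable_funD => //; apply/measurable_EFinP.
  exact: measurable_funM.
- by move=> x _; rewrite -!EFinM -EFinD lee_fin KcC.
Qed.

End H1_energy.

(** * Sign of the potential and the uniform bound on sublevel sets *)

Lemma assumption1_ge0 (R : realType) (d : nat) (D : set 'rV[R]_d)
    (V : 'rV[R]_d -> R) (Omega p : R) :
  assumption1 D V Omega p -> forall x, D x -> 0 <= V x.
Proof.
move=> [_ _ _ [[_ //]|[_ [gamma [_ VE _]]]]] x Dx.
rewrite VE// mulr_ge0 ?invr_ge0// sumr_ge0// => i _.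
by rewrite mulr_ge0 ?sqr_ge0.
Qed.

Unset Implicit Arguments.
Set Strict Implicit.

Theorem lemma2p3 (R : realType) (d : nat) (D : set 'rV[R]_d)
    (bc : boundary R d) (V : 'rV[R]_d -> R) (beta Omega omega p : R)
    (hd : (1 <= d)%N) (hD : domain D) (hbc : compatible bc D)
    (hbeta : 0 < beta) (hOmega : 0 <= Omega) (hA : assumption1 D V Omega p)
    (homega : (omega%:E < - lambda0 bc D V Omega)%E) :
  forall m : R, 0 <= m ->
    exists2 M : R, 0 < M &
      forall phi : 'rV[R]_d -> complex R,
        sublevel bc D V beta Omega omega p m phi -> (H1norm D phi <= M%:E)%E.
Proof.
move=> m m0; have [p1 _ _ _] := hA.
have mD := measurable_domain hD.
have [r r0 rP] := domain_coord_le hD.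
have muDfin : lebesgue_rV D \is a fin_num.
  by rewrite ge0_fin_numE ?measure_ge0//; exact: lebesgue_domain_lty.
pose c := 2 * beta / (p + 1).
have c0 : 0 < c by rewrite divr_gt0 ?mulr_gt0//; lra.
(* The three summands pay for the L^2 part of the rotation bound, for the [omega] term, and for one
   spare copy of the squared L^2 norm. *)
pose K := 2 * (Omega * r) ^+ 2 + `|omega| + 1.
have K0 : 0 <= K by rewrite !addr_ge0// mulr_ge0// sqr_ge0.
have [C C0 KcC] : exists2 C, 0 <= C &
    forall t, 0 <= t -> K * t ^+ 2 <= c * t `^ (p + 1) + C.
  by apply: sqr_le_powR => //; lra.
(* Four times the bound reached in [GN], to undo the factor 1/4 on the gradient. *)
pose B := 4 * (m + C * fine (lebesgue_rV D)).
have B0 : 0 <= B by rewrite mulr_ge0// addr_ge0// mulr_ge0// fine_ge0.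
(* The added 1 makes the bound strictly positive even if [B] is 0. *)
exists (B `^ 2^-1 + 1) => [|phi [[phiH1 _] phim]].
  by rewrite ltr_wpDl// powR_ge0.
have phiL2 := phiH1.1.
have IG := integrable_sqr_grad hD phiH1.
have IN := integrable_sqr_normc phiL2.
have gradE := grad_norm_sqr D phi.
have cL2E : (cLnorm D 2%:E phi ^+ 2 =
    \int[@lebesgue_rV R d]_(x in D) (Normc.normc (phi x) ^+ 2)%:E)%E.
  exact: rLnorm_sqr.
have := sqr_mod_le_powR hD _ K0 (ltW c0) C0 KcC phiL2.
have /[swap]/[apply] : p + 1 != 0 by rewrite gt_eqF//; lra.
have := LOmega_ge hD rP hOmega phiH1.
move: phim; rewrite /H1norm /action -/c cL2E gradE.
(* The integrals [G] and [N] are finite and become real numbers; the potential term [W] and the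
   power term [P] stay extended. *)
rewrite -(fineK (integrable_fin_num mD IG)) -(fineK (integrable_fin_num mD IN)).
rewrite -(fineK muDfin) -!/(Rintegral _ _ _).
set G := \int[@lebesgue_rV R d]_(x in D) _.
set N := \int[@lebesgue_rV R d]_(x in D) _.
set W := (\int[@lebesgue_rV R d]_(x in D) _)%E; set P := (_ `^ (p + 1))%E.
set J := complex.Re _; move=> phim Jge KN.
have G0 : 0 <= G.
  apply: Rintegral_ge0 => x _; apply: sumr_ge0 => i _; exact: sqr_ge0.
have N0 : 0 <= N by apply: Rintegral_ge0 => x _; exact: sqr_ge0.
have W0 : (0 <= W)%E.
  apply: integral_ge0 => x Dx; rewrite lee_fin mulr_ge0 ?sqr_ge0//.
  exact: assumption1_ge0 hA _ Dx.
have GN : 4^-1 * G + N <= m + C * fine (lebesgue_rV D).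
  have : ((2^-1 * G)%:E + 0%:E + (K * N - C * fine (lebesgue_rV D))%:E + J%:E +
      (omega * N)%:E <= m%:E)%E.
    apply: le_trans phim; rewrite !EFinM; apply: leeD => //.
    apply: leeD => //; apply: leeD; first exact: leeD.
    by rewrite EFinB leeBlDr ?EFinM.
  have := ler_wpM2r N0 (lerNnormlW (lexx `|omega|)).
  rewrite -!EFinD lee_fin /K; lra.
rewrite -EFinD poweR_EFin lee_fin.
apply: (@le_trans _ _ (B `^ 2^-1)); last by rewrite lerDl.
by rewrite ge0_ler_powR ?nnegrE ?invr_ge0 ?addr_ge0//; rewrite /B; lra.
Qed.
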